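(* Let $G$ be a finite group, $n\ge 1$, let $B$ be a standard basis of a shift-stable subgroup $I \leq G^{(\mathbb{N}^n)}$ with respect to the lexicographic order $<_{\mathrm{lex}}$, and let $d$ be a positive integer. Then the $\mathbb{N}^{n-1}$-shift-stable subgroup $$I_{[0, d-1] \times \mathbb{N}^{n-1}} := \{f \in I \mid \operatorname{supp}(f) \subseteq [0, d-1] \times \mathbb{N}^{n-1}\} \leq (G^d)^{(\mathbb{N}^{n-1})}$$ is generated, as an $\mathbb{N}^{n-1}$-shift-stable subgroup, by the finite set $$B_{[0, d-1]} := \{ {}^{t \varepsilon_1}b \mid b \in B,\ t\in\mathbb{N},\ t < d,\ \operatorname{supp}({}^{t \varepsilon_1}b) \subseteq [0, d-1] \times \mathbb{N}^{n-1} \}.$$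
   Context: $\mathbb{N}$ contains $0$. $G^{(\mathbb{N}^n)}$ is the group of finitely supported maps $f\colon\mathbb{N}^n\to G$ (''tiles'') under pointwise multiplication, where $\operatorname{supp}(f)=\{\alpha\mid f(\alpha)\ne e\}$. For $\beta\in\mathbb{N}^n$, ${}^{\beta}f(\alpha)=f(\alpha-\beta)$ if $\alpha-\beta\in\mathbb{N}^n$ and $e$ otherwise. A subgroup $I$ is shift-stable if ${}^{\beta}f\in I$ for all $f\in I$, $\beta\in\mathbb{N}^n$. $\langle S\rangle$ is the smallest shift-stable subgroup containing $S$; $S$ generates $I$ if $\langle S\rangle =I$. $\varepsilon_1=(1,0,\dots,0)\in\mathbb{N}^n$. The lexicographic order on $\mathbb{N}^n$: $\alpha<_{\mathrm{lex}}\beta$ iff for some $1\le k\le n$, $\alpha_1=\beta_1,\dots,\alpha_{k-1}=\beta_{k-1}$ and $\alpha_k<\beta_k$. For a non-trivial tile $f$, $\operatorname{multideg}(f)$ is the $<_{\mathrm{lex}}$-maximum of $\operatorname{supp}(f)$ and $\operatorname{LT}(f)$ is the tile with value $f(\operatorname{multideg}(f))$ at $\operatorname{multideg}(f)$ and $e$ elsewhere (the leading term of the trivial tile is the trivial tile). A finite $B\subseteq I$ is a standard basis of $I$ if $\langle\{\operatorname{LT}(f): f\in I\}\rangle=\langle\operatorname{LT}(b):b\in B\rangle$. For integers $x\le y$, $[x,y]=\{x,\dots,y\}$. Tiles supported in $[0,d-1]\times\mathbb{N}^{n-1}$ are identified with elements of $(G^d)^{(\mathbb{N}^{n-1})}$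 via $f\mapsto\hat f$, $\hat f(\alpha)=(f(0,\alpha),\dots,f(d-1,\alpha))$; shift-stability and generation on the right are with respect to shifts by $\mathbb{N}^{n-1}$. *)

(* Defs.v *)
From HB Require Import structures.
From mathcomp Require Import all_boot ssralg all_fingroup finmap.
From mathcomp Require Import boolp classical_sets cardinality.

Set Implicit Arguments.
Unset Strict Implicit.
Unset Printing Implicit Defensive.

Local Open Scope group_scope.
Import GRing.Theory.
Local Open Scope classical_set_scope.

(* N^n, with the pointwise addition of [nmodType]. *)
Notation "''N^' n" := {ffun 'I_n -> nat} (at level 8, n at level 2,
  format "''N^' n") : type_scope.

Section Exponents.
Context {n : nat}.
Implicit Types a b : 'N^n.

Definition mon_le b a : bool := [forall i, (b i <= a i)%N].

(* Truncated, hence only the true difference under [mon_le b a]. *)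
Definition mon_sub a b : 'N^n := [ffun i => a i - b i]%N.

Definition ltlex a b : bool :=
  [exists k : 'I_n,
    [forall j : 'I_n, (j < k)%N ==> (a j == b j)] && (a k < b k)%N].

Definition maxlex a b := if ltlex a b then b else a.

Lemma ltlexP a b : reflect
  (exists k : 'I_n, (forall j : 'I_n, (j < k)%N -> a j = b j) /\ (a k < b k)%N)
  (ltlex a b).
Proof.
apply: (iffP existsP) => -[k].
  case/andP=> /forallP h ?; exists k; split=> // j jk.
  by apply/eqP/(implyP (h j)).
case=> h ?; exists k; apply/andP; split=> //.
by apply/forallP=> j; apply/implyP=> /h /eqP.
Qed.

Lemma ltlex_irr a : ltlex a a = false.
Proof. by apply/negbTE/negP => /ltlexP[k [_]]; rewrite ltnn. Qed.

Lemma ltlex_trans : transitive ltlex.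
Proof.
move=> b a c /ltlexP[k [hk lk]] /ltlexP[l [hl ll]]; apply/ltlexP.
have [kl|lk'|/val_inj e] := ltngtP k l.
- exists k; split; last by rewrite -hl.
  by move=> j jk; rewrite hk// hl// (ltn_trans jk).
- exists l; split; last by rewrite hk.
  by move=> j jl; rewrite hk ?hl// (ltn_trans jl).
- exists k; split; last by rewrite (ltn_trans lk) // e.
  by move=> j jk; rewrite hk// hl// -e.
Qed.

Lemma ltlex_total a b : [|| a == b, ltlex a b | ltlex b a].
Proof.
have [//|/eqP ab] := eqVneq a b; rewrite /=.
have /existsP[k0 h0] : [exists i, a i != b i].
  rewrite -negb_forall; apply/negP => /forallP h.
  by apply: ab; apply/ffunP => i; apply/eqP.
have [k hk km] := @arg_minnP _ k0 (fun i => a i != b i) (@nat_of_ord n) h0.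
have h (j : 'I_n) : (j < k)%N -> a j = b j.
  by move=> jk; apply/eqP; apply: contraLR jk => /km; rewrite -leqNgt.
case: (ltngtP (a k) (b k)) => [l|l|e]; last by rewrite e eqxx in hk.
- by apply/orP; left; apply/ltlexP; exists k.
- by apply/orP; right; apply/ltlexP; exists k; split=> // j /h.
Qed.

Lemma ltlex0 a : ltlex a 0%R = false.
Proof. by apply/negbTE/negP => /ltlexP[k [_]]; rewrite ffunE. Qed.

End Exponents.

Definition eps1 {n : nat} : 'N^n.+1 := [ffun i => (i == ord0 : nat)].

Definition tile (n : nat) (G : groupType) := {fsfun 'N^n -> G with 1}.

HB.instance Definition _ n G := Choice.on (tile n G).

Section TileGroup.
Context {n : nat} {G : groupType}.
Implicit Types f g h : tile n G.

Definition tile_one : tile n G := [fsfun].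
Definition tile_mul f g : tile n G :=
  [fsfun a in (finsupp f `|` finsupp g)%fset => f a * g a].
Definition tile_inv f : tile n G := [fsfun a in finsupp f => (f a)^-1].

Lemma tile_oneE a : tile_one a = 1. Proof. exact: fsfun0E. Qed.

Lemma tile_mulE f g a : tile_mul f g a = f a * g a.
Proof.
rewrite fsfunE in_fsetU; case: ifPn => // /norP[fa ga].
by rewrite !fsfun_dflt // mulg1.
Qed.

Lemma tile_invE f a : tile_inv f a = (f a)^-1.
Proof. by rewrite fsfunE; case: finsuppP => //; rewrite invg1. Qed.

Lemma tile_mulA : associative tile_mul.
Proof. by move=> f g h; apply/fsfunP=> a; rewrite !tile_mulE mulgA. Qed.
Lemma tile_mul1 : left_id tile_one tile_mul.
Proof. by move=> f; apply/fsfunP=> a; rewrite tile_mulE tile_oneE mul1g. Qed.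
Lemma tile_mulr1 : right_id tile_one tile_mul.
Proof. by move=> f; apply/fsfunP=> a; rewrite tile_mulE tile_oneE mulg1. Qed.
Lemma tile_mulV : left_inverse tile_one tile_inv tile_mul.
Proof.
by move=> f; apply/fsfunP=> a; rewrite tile_mulE tile_invE tile_oneE mulVg.
Qed.
Lemma tile_mulrV : right_inverse tile_one tile_inv tile_mul.
Proof.
by move=> f; apply/fsfunP=> a; rewrite tile_mulE tile_invE tile_oneE mulgV.
Qed.

HB.instance Definition _ := isGroup.Build (tile n G)
  tile_mulA tile_mul1 tile_mulr1 tile_mulV tile_mulrV.

End TileGroup.

Section Tiles.
Context {n : nat} {G : groupType}.
Implicit Types (f : tile n G) (a b : 'N^n) (I S B : set (tile n G)).

Definition supp f : set 'N^n := [set a | f a <> 1].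

Definition shift b f : tile n G :=
  [fsfun a in [fset (b + x)%R | x in finsupp f]%fset =>
     if mon_le b a then f (mon_sub a b) else 1].

Lemma shiftE b f a :
  shift b f a = if mon_le b a then f (mon_sub a b) else 1.
Proof.
rewrite fsfunE; case: imfsetP => // h; case: ifP => // /forallP ba.
case: finsuppP => // fx; case: h; exists (mon_sub a b) => //.
by apply/ffunP => i; rewrite !ffunE; apply/esym/subnKC.
Qed.

Definition subgroup I :=
  [/\ I 1, (forall f g, I f -> I g -> I (f * g)) & forall f, I f -> I f^-1].

Definition shift_stable I := forall b f, I f -> I (shift b f).

Definition shift_stable_subgroup I := subgroup I /\ shift_stable I.

Definition gen S : set (tile n G) := smallest shift_stable_subgroup S.

(* Equal to the minimum 0 of N^n when f is trivial. *)
Definition multideg f : 'N^n := \big[maxlex/0%R]_(a <- finsupp f) a.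

Definition LT f : tile n G := [fsfun a in [fset multideg f]%fset => f a].

Lemma LTE f a : LT f a = if a == multideg f then f a else 1.
Proof. by rewrite fsfunE inE. Qed.

Lemma multidegP f : f <> 1 ->
  supp f (multideg f) /\
  forall a, supp f a -> a <> multideg f -> ltlex a (multideg f).
Proof.
move=> f1.
have suppE a : supp f a <-> a \in finsupp f.
  by rewrite mem_finsupp; split=> /eqP.
have max_in (s : seq 'N^n) : s <> [::] -> \big[maxlex/0%R]_(a <- s) a \in s.
  elim: s => // x s ih _; rewrite big_cons {1}/maxlex.
  case: ifP => xm; last by rewrite mem_head.
  rewrite inE ih ?orbT // => s0.
  by rewrite s0 big_nil ltlex0 in xm.
have max_ge (s : seq 'N^n) a : a \in s -> a <> \big[maxlex/0%R]_(a <- s) a ->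
    ltlex a (\big[maxlex/0%R]_(a <- s) a).
  elim: s => // x s ih; rewrite inE big_cons; set m := bigop.body _ _ _ in ih *.
  rewrite /maxlex; case: ifP => [xm /orP[/eqP-> //|]|xm /orP[/eqP-> //|as_ ax]].
    exact: ih.
  have := ltlex_total m x; rewrite xm orbF => /orP[/eqP mx|mx].
    by rewrite -mx in ax *; exact: ih.
  have [->//|/eqP am] := eqVneq a m.
  exact: ltlex_trans (ih as_ am) mx.
split=> [|a /suppE]; last exact: max_ge.
apply/suppE/max_in => f0; apply: f1; apply/fsfunP => a.
rewrite tile_oneE fsfun_dflt //; apply/negP => af.
by have : a \in enum_fset (finsupp f) by []; rewrite f0.
Qed.

Lemma LT1 : LT (1 : tile n G) = 1.
Proof. by apply/fsfunP => a; rewrite LTE tile_oneE; case: ifP. Qed.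

Definition standard_basis I B :=
  [/\ finite_set B, B `<=` I & gen (LT @` I) = gen (LT @` B)].

Definition generates S I := gen S = I.

End Tiles.

Section Slab.
Context {n : nat} {G : groupType}.
Variable d : nat.
Implicit Types (f g : tile n.+1 G) (a : 'N^n) (I B : set (tile n.+1 G)).

(* [0, d - 1] x N^n inside N^(n + 1). *)
Definition slab : set 'N^n.+1 := [set a : 'N^n.+1 | (a ord0 < d)%N].

Definition mon_cons (x : nat) a : 'N^n.+1 :=
  [ffun i => if unlift ord0 i is Some j then a j else x].

Definition mon_behead (a : 'N^n.+1) : 'N^n := [ffun j => a (lift ord0 j)].

Lemma mon_consK x a : mon_behead (mon_cons x a) = a.
Proof. by apply/ffunP => j; rewrite !ffunE liftK. Qed.

Lemma mon_cons0 x a : mon_cons x a ord0 = x.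
Proof. by rewrite ffunE unlift_none. Qed.

Lemma mon_beheadK (a : 'N^n.+1) : mon_cons (a ord0) (mon_behead a) = a.
Proof.
apply/ffunP => i; rewrite ffunE.
by case: unliftP => [j|] ->//; rewrite ffunE.
Qed.

(* The map f |-> \hat f; it is defined on all tiles, but is only injective on
   those supported in the slab. *)
Definition hat f : tile n {ffun 'I_d -> G} :=
  [fsfun a in [fset mon_behead x | x in finsupp f]%fset =>
     [ffun i : 'I_d => f (mon_cons i a)]].

Lemma hatE f a : hat f a = [ffun i : 'I_d => f (mon_cons i a)].
Proof.
rewrite fsfunE; case: imfsetP => // h; apply/ffunP => i; rewrite !ffunE.
case: finsuppP => // fx; case: h.
by exists (mon_cons i a) => //; rewrite mon_consK.
Qed.

Lemma hatM f g : hat (f * g) = hat f * hat g.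
Proof.
apply/fsfunP => a; rewrite tile_mulE !hatE; apply/ffunP => i.
by rewrite !ffunE tile_mulE.
Qed.

Lemma hat_inj f g : supp f `<=` slab -> supp g `<=` slab ->
  hat f = hat g -> f = g.
Proof.
move=> fd gd fg; apply/fsfunP => a.
have [ad|ad] := ltnP (a ord0) d.
  have := congr1 (fun h : tile n {ffun 'I_d -> G} => h (mon_behead a)) fg.
  rewrite /= !hatE => /ffunP/(_ (Ordinal ad)).
  by rewrite !ffunE /= mon_beheadK.
have out (h : tile n.+1 G) : supp h `<=` slab -> h a = 1.
  move=> hd; apply/eqP; apply: contraPT isT => /eqP /hd /=.
  by rewrite /slab /= ltnNge ad.
by rewrite !out.
Qed.

Lemma hat_surj (g : tile n {ffun 'I_d -> G}) :
  exists2 f, supp f `<=` slab & hat f = g.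
Proof.
pose v (a : 'N^n.+1) : G :=
  if insub (a ord0) is Some i then g (mon_behead a) i else 1.
pose D := [fset mon_cons (val x.1) x.2 |
  x in [seq (i, a) | i <- enum 'I_d, a <- enum_fset (finsupp g)]]%fset.
pose f : tile n.+1 G := [fsfun a in D => v a].
have fE (a : 'N^n.+1) : f a = v a.
  rewrite fsfunE; case: imfsetP => // h; rewrite /v; case: insubP => // i _ ia.
  case: finsuppP => [_|gi]; first by rewrite ffunE.
  case: h; exists (i, mon_behead a); last by rewrite /= ia mon_beheadK.
  by apply/allpairsP; exists (i, mon_behead a); rewrite mem_enum.
exists f => [a|].
  by rewrite /supp /slab /= fE /v; case: insubP.
apply/fsfunP => a; rewrite hatE; apply/ffunP => i.
by rewrite ffunE fE /v mon_cons0 mon_consK valK.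
Qed.

Definition slab_part I : set (tile n.+1 G) :=
  [set f | I f /\ supp f `<=` slab].

Definition slab_basis B : set (tile n.+1 G) :=
  [set g | exists b t, [/\ B b, (t < d)%N, g = shift (eps1 *+ t)%R b
                         & supp g `<=` slab]].

End Slab.

(* Main.v *)
(** Reduce a tile f of I supported in the slab by well-founded induction on its
    multidegree a.  As LT(f) lies in <LT(b) : b in B>, the value f(a) is a
    product of leading coefficients (or their inverses) of elements b of B with
    multideg(b) <= a componentwise.  The corresponding product g of shifts of
    the b^{+-1}, each with leading term moved to a, agrees with f at a and is
    trivial above a, so g^-1 f has smaller multidegree.  Since the
    lexicographic order looks at the first coordinate first, each such shift is
    supported in the slab, and is an N^{n-1}-shift of an element of
    B_{[0,d-1]}. *)

Require Import Defs.
From mathcomp Require Import all_boot all_fingroup classical_sets cardinality.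
From mathcomp Require Import ssralg finmap boolp.

Set Implicit Arguments.
Unset Strict Implicit.
Unset Printing Implicit Defensive.

Local Open Scope group_scope.
Local Open Scope classical_set_scope.

(** * Lexicographic order and multidegree *)

(** The order on $\mathbb{N}^{n+1}$ is the lexicographic product of the first coordinate with
    $\mathbb{N}^n$: strong induction on the head encloses well-founded induction on the tail. *)
Lemma ltlex_wf (n : nat) : well_founded (fun a b : 'N^n => ltlex a b).
Proof.
elim: n => [|n ih] a; first by constructor=> b /ltlexP[[]].
rewrite -(mon_beheadK a); move: (a ord0) (mon_behead a) => x {}a.
elim/ltn_ind: x a => x ihx a; elim/(well_founded_ind ih): a => a iha.
constructor=> b /ltlexP[k]; rewrite -(mon_beheadK b).
move: (b ord0) (mon_behead b) => y {}b.
case: (unliftP ord0 k) => [j|] -> [lo ltk].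
- have := lo ord0 isT; rewrite !mon_cons0 => ->.
  apply: iha; apply/ltlexP; exists j; split; last first.
    by rewrite !ffunE liftK in ltk.
  by move=> i ij; have := lo (lift ord0 i) ij; rewrite !ffunE liftK.
- by rewrite !mon_cons0 in ltk; exact: ihx.
Qed.

Lemma ltlex_le_head (n : nat) (a b : 'N^n.+1) :
  ltlex a b -> (a ord0 <= b ord0)%N.
Proof.
case/ltlexP=> k []; case: (unliftP ord0 k) => [j|] -> lo; last exact: ltnW.
by rewrite (lo ord0 isT).
Qed.

(** No subtraction truncates up to the deciding coordinate; [mon_sub b c] may truncate after it,
    where the comparison no longer looks. *)
Lemma ltlex_sub (n : nat) (a b c : 'N^n) :
  mon_le c a -> ltlex a b -> ltlex (mon_sub a c) (mon_sub b c).
Proof.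
move=> /forallP ca /ltlexP[k [lo ltk]]; apply/ltlexP.
exists k; split=> [j jk|]; first by rewrite !ffunE lo.
by rewrite !ffunE ltn_sub2rE.
Qed.

Lemma multideg_ge (n : nat) (G : groupType) (f : tile n G) (a : 'N^n) :
  ltlex (multideg f) a -> f a = 1.
Proof.
have [->|/eqP f1] := eqVneq f 1; first by rewrite tile_oneE.
move=> fa; apply/eqP; apply: contraT => /eqP fa1.
have [aE|/eqP aE] := eqVneq a (multideg f).
  by rewrite aE ltlex_irr in fa.
have [_ /(_ a fa1 aE) af] := multidegP f1.
by have := ltlex_trans af fa; rewrite ltlex_irr.
Qed.

(** * Tiles in the slab and the map [hat] *)

Section Hat.
Context {n : nat} {G : groupType} {d : nat}.
Implicit Types (f g : tile n.+1 G) (I B : set (tile n.+1 G)).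

Lemma supp_slabM f g : supp f `<=` slab d -> supp g `<=` slab d ->
  supp (f * g) `<=` slab d.
Proof.
move=> fd gd a; rewrite /supp /= tile_mulE => fga.
have [fa|/eqP/fd//] := eqVneq (f a) 1.
by apply: gd; rewrite fa mul1g in fga.
Qed.

Lemma supp_slabV f : supp f `<=` slab d -> supp f^-1 `<=` slab d.
Proof.
by move=> fd a fa; apply: fd => fa1; apply: fa; rewrite tile_invE fa1 invg1.
Qed.

Lemma supp_slab1 : supp (1 : tile n.+1 G) `<=` slab d.
Proof. by move=> a; rewrite /supp /= tile_oneE. Qed.

Lemma hat1 : hat d (1 : tile n.+1 G) = 1.
Proof.
apply/fsfunP => a; rewrite hatE tile_oneE; apply/ffunP => i.
by rewrite !ffunE tile_oneE.
Qed.

Lemma hatV f : hat d f^-1 = (hat d f)^-1.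
Proof.
apply/fsfunP => a; rewrite tile_invE !hatE; apply/ffunP => i.
by rewrite !ffunE tile_invE.
Qed.

Lemma mon_le_cons (b : 'N^n) (a : 'N^n.+1) :
  mon_le (mon_cons 0 b) a = mon_le b (mon_behead a).
Proof.
apply/forallP/forallP => h i.
  by have := h (lift ord0 i); rewrite !ffunE liftK.
by rewrite ffunE; case: unliftP => [j ->|//]; have := h j; rewrite ffunE.
Qed.

Lemma hat_shift (b : 'N^n) f :
  hat d (shift (mon_cons 0 b) f) = shift b (hat d f).
Proof.
apply/fsfunP => a; rewrite shiftE !hatE; apply/ffunP => i.
rewrite ffunE shiftE mon_le_cons mon_consK; case: ifP => _; rewrite !ffunE//.
 congr (f _); apply/ffunP => j; rewrite !ffunE.
by case: unliftP => [k|] _; rewrite ?subn0// ffunE.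
Qed.

Lemma supp_slab_shift (b : 'N^n) f : supp f `<=` slab d ->
  supp (shift (mon_cons 0 b) f) `<=` slab d.
Proof.
move=> fd a; rewrite /supp /= shiftE; case: ifP => // _ /fd.
by rewrite /slab /= !ffunE unlift_none subn0.
Qed.

Lemma hat_slab_part I : shift_stable_subgroup I ->
  shift_stable_subgroup (hat d @` slab_part d I).
Proof.
move=> [[I1 IM IV] Is]; split; first split.
- by exists 1; [split=> //; exact: supp_slab1 | exact: hat1].
- move=> _ _ [f [If fd] <-] [g [Ig gd] <-]; exists (f * g); last exact: hatM.
  by split; [exact: IM | exact: supp_slabM].
- move=> _ [f [If fd] <-]; exists f^-1; last exact: hatV.
  by split; [exact: IV | exact: supp_slabV].
- move=> b _ [f [If fd] <-]; exists (shift (mon_cons 0 b) f).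
    by split; [exact: Is | exact: supp_slab_shift].
  exact: hat_shift.
Qed.

Lemma finite_slab_basis B : finite_set B -> finite_set (slab_basis d B).
Proof.
move=> Bfin.
apply: (@sub_finite_set _ _
  [set shift (eps1 *+ t)%R b | t in `I_d & b in B]).
  by move=> g [b [t [Bb td -> _]]]; exists t => //; exists b.
exact: finite_image2.
Qed.

End Hat.

(** * Generated subgroups and shifts *)

Lemma gen_shift_stable_subgroup (n : nat) (G : groupType) (S : set (tile n G)) :
  shift_stable_subgroup (gen S).
Proof.
split; first split.
- by move=> J [[[]]].
- move=> f g fS gS J JS; have [[[_ JM _] _] _] := JS.
  by apply: JM; [exact: fS | exact: gS].
- by move=> f fS J JS; have [[[_ _ JV] _] _] := JS; apply: JV; exact: fS.
- by move=> b f fS J JS; have [[_ Js] _] := JS; apply: Js; exact: fS.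
Qed.

Lemma shift_shift (n : nat) (G : groupType) (a b : 'N^n) (f : tile n G) :
  shift a (shift b f) = shift (a + b)%R f.
Proof.
apply/fsfunP => c; rewrite !shiftE.
have -> : mon_le (a + b)%R c = mon_le a c && mon_le b (mon_sub c a).
  apply/forallP/andP => [h|[/forallP ac /forallP bc] i]; last first.
    by have := bc i; rewrite !ffunE leq_subRL.
  have ac i : (a i <= c i)%N.
    by have := h i; rewrite ffunE; apply: leq_trans; rewrite leq_addr.
  by split; apply/forallP => // i; have := h i; rewrite !ffunE leq_subRL.
case: ifP => //= _; case: ifP => // _; congr (f _).
by apply/ffunP => i; rewrite !ffunE subnDA.
Qed.

Lemma eps1MnE (n t : nat) (i : 'I_n.+1) :
  ((eps1 : 'N^n.+1) *+ t)%R i = ((i == ord0) * t)%N.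
Proof.
elim: t => [|t ih]; first by rewrite GRing.mulr0n ffunE muln0.
by rewrite GRing.mulrS !ffunE ih mulnS.
Qed.

(** * Reduction inside the slab *)

Section SlabReduction.
Context {n : nat} {G : groupType}.
Variables (B : set (tile n.+1 G)) (d : nat).

(** The target subgroup pulled back along [hat], so that the reduction can multiply tiles on
    $\mathbb{N}^{n+1}$, where multidegrees live. The support condition is there because [hat]
    forgets values outside the slab. *)
Definition slab_gen : set (tile n.+1 G) :=
  [set f | supp f `<=` slab d /\ gen (hat d @` slab_basis d B) (hat d f)].

Lemma slab_gen_subgroup : subgroup slab_gen.
Proof.
have [[g1 gM gV] _] := gen_shift_stable_subgroup (hat d @` slab_basis d B).
split=> [|f g [fd fg] [gd gg]|f [fd fg]].
- by split; [exact: supp_slab1 | rewrite hat1].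
- by split; [exact: supp_slabM | rewrite hatM; exact: gM].
- by split; [exact: supp_slabV | rewrite hatV; exact: gV].
Qed.

Lemma slab_gen_shift (b : tile n.+1 G) (a : 'N^n.+1) :
  B b -> mon_le (multideg b) a -> slab d a ->
  slab_gen (shift (mon_sub a (multideg b)) b).
Proof.
move=> Bb /forallP ba ad; set c := mon_sub a _.
have c0 : (multideg b ord0 + c ord0)%N = a ord0 by rewrite ffunE subnKC.
(* Support points of [b] have first coordinate at most that of [multideg b], which the shift by [c]
   moves to [a ord0 < d]. *)
have lead (x : 'N^n.+1) : b x <> 1 -> (x ord0 + c ord0 < d)%N.
  move=> bx; have xb : (x ord0 <= multideg b ord0)%N.
    have := ltlex_total x (multideg b).
    by case/or3P=> [/eqP->//|/ltlex_le_head//|/multideg_ge].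
  by apply: leq_ltn_trans ad; rewrite -c0 leq_add2r.
(* First move along $\varepsilon_1$ only, which gives an element of [slab_basis]; the remaining
   shift fixes the first coordinate and commutes with [hat]. *)
have -> : shift c b =
    shift (mon_cons 0 (mon_behead c)) (shift (eps1 *+ c ord0)%R b).
  rewrite shift_shift; congr shift; apply/ffunP => i.
  rewrite [in RHS]ffunE eps1MnE.
  case: (unliftP ord0 i) => [j|] ->; last by rewrite mon_cons0 eqxx mul1n.
  by rewrite [mon_cons _ _ _]ffunE liftK mul0n GRing.addr0 [in RHS]ffunE.
have ed : supp (shift (eps1 *+ c ord0)%R b) `<=` slab d.
  move=> x; rewrite /supp /= shiftE; case: ifP => // /forallP/(_ ord0).
  by rewrite eps1MnE mul1n => cx /lead; rewrite ffunE eps1MnE mul1n subnK.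
split; first exact: supp_slab_shift.
have [_ gs] := gen_shift_stable_subgroup (hat d @` slab_basis d B).
rewrite hat_shift; apply: gs; apply: sub_gen_smallest.
exists (shift (eps1 *+ c ord0)%R b) => //; exists b, (c ord0); split=> //.
by apply: leq_ltn_trans ad; rewrite -c0 leq_addl.
Qed.

(* Stated for every [c] above [a], so that the condition on [h] is invariant
   under all shifts although [slab_gen] is only invariant under those fixing
   the first coordinate. *)
Lemma slab_gen_leading (h : tile n.+1 G) (a c : 'N^n.+1) :
  gen (LT @` B) h -> mon_le a c -> slab d c ->
  exists g, [/\ slab_gen g, g c = h a & forall x, ltlex c x -> g x = 1].
Proof.
(* It suffices that [J] is a shift-stable subgroup containing the leading terms of [B]. *)
pose J : set (tile n.+1 G) := [set h | forall a c, mon_le a c -> slab d c ->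
  exists g, [/\ slab_gen g, g c = h a & forall x, ltlex c x -> g x = 1]].
have [K1 KM KV] := slab_gen_subgroup.
suff: gen (LT @` B) `<=` J by move=> + gh; exact.
apply: smallest_sub; first split; first split.
- by move=> {}a {}c _ _; exists 1; split=> // [|x _]; rewrite !tile_oneE.
- move=> f g Jf Jg {}a {}c ac cd.
  have [f' [Kf f'c f'1]] := Jf a c ac cd.
  have [g' [Kg g'c g'1]] := Jg a c ac cd.
  exists (f' * g'); split=> [||x cx]; first exact: KM.
    by rewrite !tile_mulE f'c g'c.
  by rewrite tile_mulE f'1// g'1// mulg1.
- move=> f Jf {}a {}c ac cd; have [f' [Kf f'c f'1]] := Jf a c ac cd.
  exists f'^-1; split=> [||x cx]; first exact: KV.
    by rewrite !tile_invE f'c.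
  by rewrite tile_invE f'1// invg1.
(* The shifted tile takes at [a] either the value of [f] at [a - b], still below [c], or the value
   [1]. *)
- move=> b f Jf {}a {}c /forallP ac cd; rewrite shiftE; case: ifP => _.
    apply: Jf => //; apply/forallP => i; rewrite ffunE.
    exact: leq_trans (leq_subr _ _) (ac i).
  by exists 1; split=> // [|x _]; rewrite !tile_oneE.
- move=> _ [b Bb <-] {}a {}c ac cd; rewrite LTE.
  case: eqP => [aE|_]; last first.
    by exists 1; split=> // [|x _]; rewrite !tile_oneE.
  (* The witness is [b] itself, shifted so that its leading term sits at [c]. *)
  rewrite aE in ac *; exists (shift (mon_sub c (multideg b)) b).
  have /forallP bc := ac.
  split=> [||x cx]; first exact: slab_gen_shift.
    rewrite shiftE ifT; last by apply/forallP => i; rewrite ffunE leq_subr.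
    by congr (b _); apply/ffunP => i; rewrite !ffunE subKn.
  rewrite shiftE; case: ifP => // _; apply: multideg_ge.
  set e := mon_sub c (multideg b).
  suff -> : multideg b = mon_sub c e.
    by apply: ltlex_sub cx; apply/forallP => i; rewrite ffunE leq_subr.
  by apply/ffunP => i; rewrite !ffunE subKn.
Qed.

Lemma gen_hat_slab_basis_sub (I : set (tile n.+1 G)) :
  shift_stable_subgroup I -> B `<=` I ->
  gen (hat d @` slab_basis d B) `<=` hat d @` slab_part d I.
Proof.
move=> Iss BI; apply: smallest_sub; first exact: hat_slab_part.
move=> _ [_ [b [t [Bb _ -> bd]]] <-]; exists (shift (eps1 *+ t)%R b) => //.
by split=> //; have [_ Is] := Iss; apply/Is/BI.
Qed.

(** Injectivity of [hat] on the slab gives this; it keeps the remainder in [I] after each reduction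
    step. *)
Lemma slab_gen_sub (I : set (tile n.+1 G)) :
  shift_stable_subgroup I -> B `<=` I -> slab_gen `<=` I.
Proof.
move=> Iss BI f [fd /(gen_hat_slab_basis_sub Iss BI)[g [Ig gd]]].
by move=> /hat_inj <-.
Qed.

Lemma slab_part_sub_slab_gen (I : set (tile n.+1 G)) :
  shift_stable_subgroup I -> standard_basis I B -> slab_part d I `<=` slab_gen.
Proof.
move=> Iss [_ BI genE] f; have [[_ IM IV] _] := Iss.
have [K1 KM _] := slab_gen_subgroup.
move: {2}(multideg f) (erefl (multideg f)) => a.
elim/(well_founded_ind (@ltlex_wf n.+1)): a f => a ih f fa [If fd].
have [->//|/eqP f1] := eqVneq f 1.
have [ma _] := multidegP f1; rewrite fa in ma.
have LTf : gen (LT @` B) (LT f).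
  by rewrite -genE; apply: sub_gen_smallest; exists f.
have [g [Kg ga g1]] : exists g, [/\ slab_gen g, g a = LT f a &
    forall x, ltlex a x -> g x = 1].
  by apply: slab_gen_leading => //; [exact/forallP | exact: fd].
rewrite LTE fa eqxx in ga.
have -> : f = g * (g^-1 * f) by rewrite mulKVg.
apply: KM => //; have [gd _] := Kg.
have [->//|/eqP r1] := eqVneq (g^-1 * f) 1.
apply: (ih (multideg (g^-1 * f))) => //; last first.
  split; first by apply: IM => //; apply/IV/(slab_gen_sub Iss BI).
  by apply: supp_slabM => //; exact: supp_slabV.
have [mr _] := multidegP r1; move: mr; set m := multideg _.
rewrite /supp /= tile_mulE tile_invE.
(* At [a] the values of [g] and [f] cancel, and above [a] both are trivial, so the remainder has
   multidegree below [a]. *)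
have /or3P[/eqP->|//|am] := ltlex_total m a; first by rewrite ga mulVg.
by rewrite g1// multideg_ge ?fa// invg1 mulg1.
Qed.

End SlabReduction.

Theorem theorem3p13 (G : finGroupType) (n : nat)
    (I B : set (tile n.+1 G)) (d : nat) :
  shift_stable_subgroup I -> standard_basis I B -> (0 < d)%N ->
  [/\ shift_stable_subgroup (hat d @` slab_part d I),
      finite_set (slab_basis d B)
    & generates (hat d @` slab_basis d B) (hat d @` slab_part d I)].
Proof.
move=> Iss sB _; have [Bfin BI _] := sB.
split; [exact: hat_slab_part | exact: finite_slab_basis |].
apply/seteqP; split=> [|_ [f If <-]].
  exact: gen_hat_slab_basis_sub.
by have [] := slab_part_sub_slab_gen Iss sB If.
Qed.
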